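(* Let $G$ be a group, let $H\le G$ be a malnormal subgroup of finite index, and let $S$ be a multiset of elements of $G$ of size $[G:H]$ which generates $G$. Then $S$ can be Nielsen transformed to a left-right transversal of $H$ in $G$.
   Context: A subgroup $H\le G$ is malnormal if $xHx^{-1}\cap H=\{e\}$ for every $x\in G\setminus H$. A left (resp. right) transversal of $H$ in $G$ is a set containing exactly one element of each left coset $gH$ (resp. each right coset $Hg$). A left-right transversal is a set which is simultaneously a left and a right transversal. Given a finite multiset $S$ of elements of $G$, a Nielsen move on $S$ is either (1) replacing some entry $g$ of $S$ by $g^{-1}$, or (2) replacing some entry $g$ of $S$ by $hg$ or $gh$, where $h$ is another entry of $S$ (a different occurrence in the multiset, possibly equal to $g$ as a group element). A Nielsen transformation is a finite sequence of Nielsen moves. *)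

(* Defs.v *)
From Stdlib Require Export Relation_Operators.
From mathcomp Require Export all_boot finmap multiset.
From mathcomp Require Export boolp classical_sets functions cardinality.

Set Implicit Arguments.
Unset Strict Implicit.
Unset Printing Implicit Defensive.

Local Open Scope fset_scope.
Local Open Scope mset_scope.
Local Open Scope classical_set_scope.
Local Open Scope group_scope.

Section Defs.
Variable G : groupType.
Implicit Types (H T : set G) (S : {mset G}) (g h x : G).

Definition is_subgroup H : Prop := group_closed [in H].

Definition lcoset g H : set G := [set g * h | h in H].
Definition rcoset H g : set G := [set h * g | h in H].
Definition conjugate x H : set G := [set x * h * x^-1 | h in H].

Definition malnormal H : Prop :=
  forall x, ~ H x -> conjugate x H `&` H = [set 1].

Definition lcosets H : set (set G) := [set lcoset g H | g in setT].
Definition rcosets H : set (set G) := [set rcoset H g | g in setT].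

Definition finite_index H : Prop := finite_set (lcosets H).
Definition subgroup_index H : nat := #|` fset_set (lcosets H)|.

Definition left_transversal H T : Prop :=
  forall C, lcosets H C -> exists! t, (T `&` C) t.
Definition right_transversal H T : Prop :=
  forall C, rcosets H C -> exists! t, (T `&` C) t.
Definition left_right_transversal H T : Prop :=
  left_transversal H T /\ right_transversal H T.

Definition generates S : Prop := smallest is_subgroup [set` S] = setT.

(* The entry being replaced is split off from the multiset, so in the last two
   moves g and h are different occurrences, possibly with g = h in G. The casts
   make the results multisets over the same choiceType instance as S. *)
Inductive nielsen_move : {mset G} -> {mset G} -> Prop :=
| NielsenInv g S : nielsen_move (g +` S) ((g^-1 : G) +` S)
| NielsenMulL g h S : nielsen_move (g +` (h +` S)) ((h * g : G) +` (h +` S))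
| NielsenMulR g h S : nielsen_move (g +` (h +` S)) ((g * h : G) +` (h +` S)).

Definition nielsen_transformation : {mset G} -> {mset G} -> Prop :=
  clos_refl_trans {mset G} nielsen_move.

End Defs.

(* Main.v *)
(* If H = G then S is a single element. Otherwise h |-> h x H is injective on H
   for x outside H, so G is finite. Write n = [G : H].

   Two entries sharing a left (right) coset, x and y, can be replaced by x and
   x^-1 y (resp. x and y x^-1), so S becomes O ++ hs with hs in H and O outside
   H, meeting every left and every right coset at most once. If hs has a single
   entry, counting shows that this is a left-right transversal. Otherwise O can
   be enlarged. An entry that lies in the subgroup generated by the others can
   be replaced by any element of G, in particular by one in a free left and a
   free right coset, so assume that no entry of hs is of this kind. Remove h
   from hs, leaving t, and let M be the proper subgroup generated by O ++ t and
   C the intersection of M and H.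
   - By malnormality C acts freely on the nontrivial cosets of H in G and of C
     in M, so |C| divides n - [M : C] < size hs. Since |C| >= 2^(size hs - 1),
     this forces [M : C] >= n.
   - Extract from O an irredundant O' such that O' ++ t still generates M. Then
     n (n - 1) >= |G| >= 2 |M| >= 6 * 2^j with j = size O', hence n > 2 j + 1.
   - Each coset of H meets h M in at most |C| elements, so some x in h M avoids
     H and all left and right cosets of O'. Replace h by x: now O', x and t
     generate G, and the entries of O left out of O' are free to be moved to
     free cosets. *)

From HB Require Import structures.
Require Import Defs.
From mathcomp Require Import all_boot all_fingroup zify.

Set Implicit Arguments.
Unset Strict Implicit.
Unset Printing Implicit Defensive.

Local Open Scope group_scope.

(** * Finite groups as instances of [finGroupType] *)

Lemma finite_groupP (G : groupType) :
  finite_set [set: G]%classic -> exists gT : finGroupType, (gT : groupType) = G.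
Proof.
(* G is split into its mixins so that gT, packed from the same mixins, is
   convertible to it. *)
case/finite_seqP=> s; case: G s => T [? ? ? ? ? ? ? ? ?] s.
set G := (X in set (Group.sort X)) => sT.
have s_full (x : G) : x \in s.
  by have: [set: G]%classic x by []; rewrite sT.
have idxK : pcancel (fun x : G => index x s) (onth s).
  by move=> x; rewrite onthE (nth_map x) ?nth_index ?index_mem.
pose cm := Choice_isCountable.Build G idxK.
have us : Finite.axiom (undup s).
  by move=> x; rewrite count_uniq_mem ?undup_uniq // mem_undup s_full.
pose fm := isFinite.Build G us.
pose gT : finGroupType := HB.pack G cm fm.
by exists gT.
Qed.

(** * Nielsen moves on sequences in a finite group *)

Section Nielsen.
Variable gT : finGroupType.
Implicit Types (x y a b h : gT) (s t p J : seq gT).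

(** The second conjunct lets every chain of moves carry along the fact that the entries generate
    [G]. *)
Definition nielsen_equiv s t :=
  nielsen_transformation (seq_mset s) (seq_mset t) /\
  <<[set:: s]>> = <<[set:: t]>>.

Lemma nielsen_refl s : nielsen_equiv s s.
Proof. by split=> //; exact: rt_refl. Qed.

Lemma nielsen_trans s t p :
  nielsen_equiv s t -> nielsen_equiv t p -> nielsen_equiv s p.
Proof. by case=> m1 g1 [m2 g2]; split; [exact: rt_trans m1 m2 | rewrite g1]. Qed.

Lemma eq_gen_mem s t : s =i t -> <<[set:: s]>> = <<[set:: t]>>.
Proof. by move=> st; congr <<_>>; apply/setP=> x; rewrite !inE. Qed.

Lemma nielsen_perm s t : perm_eq s t -> nielsen_equiv s t.
Proof.
move=> st; split; last exact/eq_gen_mem/perm_mem.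
by move/eq_seq_msetP: st => ->; exact: rt_refl.
Qed.

Lemma mem_genl x s : x \in s -> x \in <<[set:: s]>>.
Proof. by move=> xs; rewrite mem_gen // inE. Qed.

Lemma gen_seqS s t : {subset s <= t} -> <<[set:: s]>> \subset <<[set:: t]>>.
Proof. by move=> st; apply/genS/subsetP=> x; rewrite !inE; exact: st. Qed.

Lemma gen_seq_sub s (K : {group gT}) :
  (<<[set:: s]>> \subset K) = all [in K] s.
Proof.
rewrite gen_subG; apply/subsetP/allP=> sK x; have := sK x; rewrite !inE; exact.
Qed.

Lemma gen_cons x y s :
  x \in <<[set:: y :: s]>> -> y \in <<[set:: x :: s]>> ->
  <<[set:: x :: s]>> = <<[set:: y :: s]>>.
Proof.
move=> xy yx; apply/eqP.
rewrite eqEsubset !gen_seq_sub /= xy yx /=.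
by apply/andP; split; apply/allP=> z zs; rewrite /= mem_genl // inE zs orbT.
Qed.

Lemma nielsenV x s : nielsen_equiv (x :: s) (x^-1 :: s).
Proof.
split; first by rewrite !mset_cons; exact/rt_step/NielsenInv.
by apply: gen_cons; rewrite -groupV ?invgK mem_genl ?mem_head.
Qed.

Lemma nielsenL x h s : h \in s -> nielsen_equiv (x :: s) (h * x :: s).
Proof.
move=> hs; split.
  have/eq_seq_msetP e := perm_to_rem hs.
  by rewrite !mset_cons e mset_cons; exact/rt_step/NielsenMulL.
have hg z : h \in <<[set:: z :: s]>> by rewrite mem_genl // inE hs orbT.
apply: gen_cons; first by rewrite -(groupMl _ (hg _)) mem_genl ?mem_head.
by rewrite groupM ?hg // mem_genl ?mem_head.
Qed.

(** In a finite group [a] is a product of entries of [s] without inverses, so its factors can be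
    multiplied on one at a time. *)
Lemma nielsenMl x a s :
  a \in <<[set:: s]>> -> nielsen_equiv (x :: s) (a * x :: s).
Proof.
case/gen_prodgP=> n [c cs ->]; elim: n c cs => [|n IHn] c cs.
  by rewrite big_ord0 mul1g; exact: nielsen_refl.
rewrite big_ord_recl -mulgA; apply: nielsen_trans (nielsenL _ _).
  by apply: IHn => i; exact: cs.
by have := cs ord0; rewrite inE.
Qed.

Lemma nielsenMr x a s :
  a \in <<[set:: s]>> -> nielsen_equiv (x :: s) (x * a :: s).
Proof.
move=> aS; rewrite -[x * a]invgK invMg.
apply: nielsen_trans (nielsenV _ _).
apply: nielsen_trans (nielsenV _ _) _.
by apply: nielsenMl; rewrite groupV.
Qed.

Lemma nielsen_spare x y s :
  x \in <<[set:: s]>> -> y \in <<[set:: s]>> -> nielsen_equiv (x :: s) (y :: s).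
Proof.
move=> xs ys; rewrite -[y](mulgKV x); apply: nielsenMl.
by rewrite groupM ?groupV.
Qed.

(** A replaced entry joins [J] for the rest of the induction, which only enlarges the subgroup
    available to the remaining entries. *)
Lemma nielsen_spares J p t :
  size p = size t -> all [in <<[set:: J]>>] p -> all [in <<[set:: J]>>] t ->
  nielsen_equiv (J ++ p) (J ++ t).
Proof.
elim: p t J => [|x p IHp] [|y t] J //=; first by move=> *; exact: nielsen_refl.
move=> [spt] /andP[xJ pJ] /andP[yJ tJ].
have toC z q : nielsen_equiv (J ++ z :: q) (z :: J ++ q).
  by apply: nielsen_perm; rewrite perm_catC /= perm_cons perm_catC.
have ofC z q : nielsen_equiv (z :: J ++ q) (J ++ z :: q).
  by apply: nielsen_perm; rewrite perm_sym perm_catC /= perm_cons perm_catC.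
have subJp : <<[set:: J]>> \subset <<[set:: J ++ p]>>.
  by apply: gen_seqS => w wJ; rewrite mem_cat wJ.
have subJy : <<[set:: J]>> \subset <<[set:: y :: J]>>.
  by apply: gen_seqS => w wJ; rewrite inE wJ orbT.
apply: nielsen_trans (toC _ _) _.
apply: nielsen_trans (ofC _ _).
apply: (@nielsen_trans _ (y :: J ++ p)).
  by apply: nielsen_spare; apply: (subsetP subJp).
apply: (IHp t (y :: J)) => //; apply/allP => z.
  by move/(allP pJ)/(subsetP subJy).
by move/(allP tJ)/(subsetP subJy).
Qed.

End Nielsen.

(** * Malnormality and the counting of cosets *)

Section Cosets.
Variable gT : finGroupType.
Implicit Types (x y h : gT) (s t O : seq gT) (L M C H : {group gT}).

(** Relative to [L], because the property is passed from [G] to subgroups generated by some of the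
    entries. *)
Definition malnormal_in (L C : {set gT}) :=
  forall x h, x \in L -> x \notin C -> h \in C -> h ^ x \in C -> h = 1.

Lemma malnormalI L M H :
  M \subset L -> malnormal_in L H -> malnormal_in M (M :&: H).
Proof.
move=> /subsetP ML mal x h xM; rewrite !inE xM /= => xH /andP[_ hH] /andP[_ hxH].
by apply: mal hxH => //; exact: ML.
Qed.

(* C acts freely by right translation on the nontrivial right cosets of C. *)
Lemma malnormal_dvd_index L C :
  C \subset L -> malnormal_in L C -> #|C| %| #|L : C|.-1.
Proof.
move=> CL mal.
have CX : (C : {set gT}) \in rcosets C L.
  by apply/rcosetsP; exists 1; rewrite ?mulg1.
have -> : #|L : C|.-1 = #|rcosets C L :\ (C : {set gT})|.
  by rewrite [#|L : C|](cardsD1 (C : {set gT})) CX.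
have act : [acts C, on rcosets C L :\ (C : {set gT}) | 'Rs].
  apply: actsD; first exact: subset_trans (actsRs_rcosets C L).
  by rewrite astabs_set1 astab1Rs.
rewrite -(acts_sum_card_orbit act); apply: dvdn_sum => A /imsetP[B].
rewrite !inE => /andP[BC /rcosetsP[x xL eB]] ->.
(* If [c] fixes the coset [C x], then [x c x^-1] lies in [C] and malnormality forces [c = 1]: every
   orbit has [#|C|] elements. *)
rewrite card_orbit; suff -> : 'C_C[B | 'Rs] = 1 by rewrite indexg1.
apply/trivgP/subsetP=> c /setIP[cC /astab1P/=]; rewrite inE eB rcosetE -rcosetM.
move/eqP; rewrite eqEsubset => /andP[/subsetP/(_ (x * c))].
rewrite rcoset_refl => /(_ isT); rewrite mem_rcoset => xcx _.
apply/eqP; apply: (mal x^-1); rewrite ?groupV //.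
  by apply: contra BC => xC; rewrite eB rcoset_id.
by rewrite conjgE invgK mulgA.
Qed.

(** The index minus one is a positive multiple of [#|C|]. *)
Lemma malnormal_index_gt L C :
  C \subset L -> ~~ (L \subset C) -> malnormal_in L C -> #|C| < #|L : C|.
Proof.
move=> CL nLC mal; have := malnormal_dvd_index CL mal.
have : 1 < #|L : C| by rewrite indexg_gt1.
by case: #|L : C| => [|[|n]] //= _ /dvdn_leq; apply.
Qed.

Lemma leq_index L H s :
  {subset s <= L} -> pairwise (fun x y => x^-1 * y \notin H) s ->
  size s <= #|L : L :&: H|.
Proof.
(* Inversion turns left cosets into right cosets, the ones that [#|L : _|] counts. *)
move=> sL sep; rewrite -(size_map (fun x => (L :&: H) :* x^-1)).
rewrite [#|_ : _|]cardE; apply: uniq_leq_size.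
  rewrite uniq_pairwise pairwise_map; apply: sub_pairwise sep => x y /=.
  apply: contraNneq => /(congr1 (fun A : {set gT} => x^-1 \in A)).
  by rewrite rcoset_refl mem_rcoset invgK inE => /esym/andP[].
move=> A /mapP[x xs ->]; rewrite mem_enum mem_rcosets.
by rewrite -[x^-1]mul1g mem_mulg // groupV sL.
Qed.

End Cosets.

(** * Partial transversals: extension and Nielsen reduction *)

Section PartialTransversals.
Variables (gT : finGroupType) (H : {group gT}).
Implicit Types (x y h : gT) (s t p O hs : seq gT) (K L M : {group gT}).

Let G := [set: gT]%G.

Definition separated x y := (x^-1 * y \notin H) && (x * y^-1 \notin H).

(** The trivial coset is left free: the single entry remaining in [H] takes it at the end. *)
Definition partial_transversal O := all [predC H] O && pairwise separated O.

Lemma separated_sym : symmetric separated.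
Proof.
move=> x y; rewrite /separated -(groupV _ (x^-1 * y)) -(groupV _ (x * y^-1)).
by rewrite !invMg !invgK.
Qed.

Lemma pairwise_separated_mem s x y :
  pairwise separated s -> x \in s -> y \in s -> x = y \/ separated x y.
Proof.
elim: s => //= z s IHs /andP[/allP zs /IHs{}IHs].
rewrite !inE => /predU1P[->|xs] /predU1P[->|ys]; first by left.
- by right; apply: zs.
- by right; rewrite separated_sym; apply: zs.
- exact: IHs.
Qed.

Lemma partial_transversal_cons x O :
  partial_transversal (x :: O) =
  [&& x \notin H, all (separated x) O & partial_transversal O].
Proof. by rewrite /partial_transversal /= -!andbA; congr andb; rewrite andbCA. Qed.

Lemma partial_transversal_subseq s O :
  subseq s O -> partial_transversal O -> partial_transversal s.
Proof.
move=> sO /andP[/allP OH sep]; rewrite /partial_transversal.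
rewrite (subseq_pairwise sO) // andbT; apply/allP=> x /(mem_subseq sO).
exact: OH.
Qed.

(** Adjoining 1, which represents the trivial coset, makes the bound strict. *)
Lemma partial_transversal_size O L :
  partial_transversal O -> {subset O <= L} -> size O < #|L : L :&: H|.
Proof.
case/andP=> /allP OH sep OL; apply: (@leq_index _ _ _ (1 :: O)).
  by move=> x; rewrite inE => /predU1P[->|/OL].
rewrite /= (sub_pairwise _ sep) ?andbT => [|x y /andP[]//].
by apply/allP=> x /OH; rewrite invg1 mul1g.
Qed.

(** [1 :: O] is too short to meet every left coset, so some [g H] is free. The elements [g * k] with
    [k] in [H] run through it, and one of them must lie in a free right coset. *)
Lemma partial_transversal_extend O :
  partial_transversal O -> (size O).+1 < #|G : H| ->
  exists x, partial_transversal (x :: O).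
Proof.
move=> ptO ltO; have /andP[/allP OH sep] := ptO.
have [g gfree] : exists g, all (fun y => y^-1 * g \notin H) (1 :: O).
  apply/existsP; rewrite -[[exists _, _]]negbK negb_exists.
  apply: contraTN ltO => /forallP full; rewrite -leqNgt.
  rewrite -[_.+1](size_map (fun y => H :* y^-1) (1 :: O)) [#|_ : _|]cardE.
  apply: uniq_leq_size (enum_uniq _) _ => A; rewrite mem_enum => /rcosetsP[g _ ->].
  have /allPn[y yO] := full g^-1; rewrite negbK => yg.
  apply/mapP; exists y => //; apply/rcoset_eqP.
  by rewrite mem_rcoset invgK -groupV invMg.
have {gfree} [gH /allP gO] : g \notin H /\ all (fun y => y^-1 * g \notin H) O.
  by move: gfree; rewrite /= invg1 mul1g => /andP.
have [/existsP[k /andP[kH kO]]|] :=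
    boolP [exists k, (k \in H) && all (fun y => g * k * y^-1 \notin H) O].
  exists (g * k); rewrite partial_transversal_cons ptO andbT groupMr // gH /=.
  apply/allP=> y yO; rewrite /separated (allP kO) // andbT.
  by rewrite -groupV !invMg !invgK mulgA groupMr ?gO.
rewrite negb_exists => /forallP blocked.
(* Each g k with k in H shares its right coset with some f k in O; then
   f k = u g k with u in H - {1}, and u determines k: too many k. *)
pose f k := nth 1 O (find (fun y => g * k * y^-1 \in H) O).
have fP k : k \in H -> f k \in O /\ g * k * (f k)^-1 \in H.
  move=> kH; have: has (fun y => g * k * y^-1 \in H) O.
    have := blocked k; rewrite kH /= -has_predC.
    by apply: sub_has => y /=; rewrite negbK.
  by move=> hk; split; [rewrite mem_nth -?has_find | exact: (nth_find 1 hk)].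
have: #|H| <= #|H :\ 1|.
  have <- : #|(fun k => f k * (g * k)^-1) @: H| = #|H|.
    apply: card_in_imset => k k' kH k'H /= e.
    have [fk gk] := fP k kH; have [fk' gk'] := fP k' k'H.
    (* Equal values of [u] give [(f k)^-1 * f k' = k^-1 * k'], so [f k] and [f k'] share a left
       coset and coincide. *)
    have ff : f k = f k'.
      have [//|/andP[]] := pairwise_separated_mem sep fk fk'.
      suff -> : (f k)^-1 * f k' = k^-1 * k' by case/negP; rewrite groupM ?groupV.
      rewrite -[f k'](mulgKV (g * k')) -e.
      by rewrite !mulgA mulVg mul1g invMg mulgKV.
    by move: e; rewrite ff => /mulgI/invg_inj/mulgI.
  apply/subset_leq_card/subsetP=> _ /imsetP[k kH ->]; have [fk gk] := fP k kH.
  rewrite !inE; apply/andP; split; last by rewrite -groupV invMg invgK.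
  (* [u = 1] would mean [f k = g * k], an entry of [O] in the free coset [g H]. *)
  apply: contraNneq (gO _ fk) => /eqP.
  by rewrite -eq_mulgV1 => /eqP->; rewrite invMg mulgKV groupV.
by rewrite (cardsD1 1 H) group1 ltnn.
Qed.

Lemma nielsen_reduce s :
  exists O hs, [/\ nielsen_equiv s (O ++ hs), partial_transversal O,
    all [in H] hs & size O + size hs = size s].
Proof.
(* [t] holds the entries still to be sorted; [O] and [hs] accumulate those outside and inside
   [H]. *)
suff red t O hs : partial_transversal O -> all [in H] hs ->
    exists O' hs', [/\ nielsen_equiv (t ++ O ++ hs) (O' ++ hs'),
      partial_transversal O', all [in H] hs' &
      size O' + size hs' = size t + (size O + size hs)].
  have [//|//|O [hs]] := red s [::] [::].
  by rewrite /= cats0 !addn0 => redO; exists O, hs.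
elim: t O hs => [|x t IHt] O hs ptO hsH.
  by exists O, hs; split => //; exact: nielsen_refl.
have toH h : h \in H -> nielsen_equiv (x :: t ++ O ++ hs) (h :: t ++ O ++ hs) ->
    exists O' hs', [/\ nielsen_equiv (x :: t ++ O ++ hs) (O' ++ hs'),
      partial_transversal O', all [in H] hs' &
      size O' + size hs' = size (x :: t) + (size O + size hs)].
  move=> hH xh; have [||O' [hs' [m ptO' hsH' sz]]] := IHt O (h :: hs) => //=.
    by rewrite hH.
  exists O', hs'; split => //; last by rewrite sz /=; lia.
  apply: nielsen_trans xh (nielsen_trans _ m); apply: nielsen_perm.
  by rewrite !catA perm_sym perm_catC /= perm_cons perm_catC.
have [xH|xH] := boolP (x \in H); first exact: toH (nielsen_refl _).
have [xO|/allPn[y yO]] := boolP (all (separated x) O).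
  have [||O' [hs' [m ptO' hsH' sz]]] := IHt (x :: O) hs => //.
    by rewrite partial_transversal_cons xH xO.
  exists O', hs'; split => //; last by rewrite sz /=; lia.
  apply: nielsen_trans m; apply: nielsen_perm.
  by rewrite perm_sym perm_catC /= perm_cons perm_catC.
have ygen : y \in <<[set:: t ++ O ++ hs]>>.
  by rewrite mem_genl // !mem_cat yO orbT.
rewrite negb_and !negbK => /orP[xy|xy].
  apply: (toH (y^-1 * x)); first by rewrite -groupV invMg invgK.
  by apply: nielsenMl; rewrite groupV.
by apply: (toH (x * y^-1)) => //; apply: nielsenMr; rewrite groupV.
Qed.

(** As [O ++ t] generates [G], the entries of [p] can be exchanged for arbitrary elements, here
    chosen one by one with [partial_transversal_extend]. *)
Lemma nielsen_refill O t p :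
  partial_transversal O -> <<[set:: O ++ t]>> = G ->
  size O + size p < #|G : H| ->
  exists q, [/\ size q = size p, partial_transversal (q ++ O) &
    nielsen_equiv ((O ++ t) ++ p) ((q ++ O) ++ t)].
Proof.
move=> ptO gen ltO.
have [q [szq ptq]] : exists q, size q = size p /\ partial_transversal (q ++ O).
  elim: p ltO => [|z p IHp] /= ltO; first by exists [::].
  have [|q [szq ptq]] := IHp; first by move: ltO; rewrite addnS => /ltnW.
  have [|x ptx] := partial_transversal_extend ptq.
    by rewrite size_cat szq addnC -addnS.
  by exists (x :: q); rewrite /= szq.
exists q; split => //; apply: (@nielsen_trans _ _ ((O ++ t) ++ q)).
  by apply: nielsen_spares => //; rewrite gen; apply/allP=> x _; rewrite inE.
by apply: nielsen_perm; rewrite perm_catC catA.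
Qed.

(** * Orders of generated subgroups *)

Lemma double_card K L : K \subset L -> ~~ (L \subset K) -> 2 * #|K| <= #|L|.
Proof.
by move=> KL nLK; rewrite -(Lagrange KL) mulnC leq_mul2l indexg_gt1 nLK orbT.
Qed.

Lemma double_card_gen x t :
  x \notin <<[set:: t]>> -> 2 * #|<<[set:: t]>>| <= #|<<[set:: x :: t]>>|.
Proof.
move=> xt; apply: double_card.
  by apply: gen_seqS => y yt; rewrite inE yt orbT.
apply: contra xt => /subsetP; apply; exact/mem_genl/mem_head.
Qed.

(** When the entries are adjoined one by one, each at least doubles the generated subgroup. *)
Lemma irredundant_card t :
  {in t, forall x, x \notin <<[set:: rem x t]>>} -> 2 ^ size t <= #|<<[set:: t]>>|.
Proof.
elim: t => [|x t IHt] irr; first exact: cardG_gt0.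
rewrite /= expnS.
have xt : x \notin <<[set:: t]>> by have := irr x (mem_head _ _); rewrite /= eqxx.
apply: leq_trans (double_card_gen xt); rewrite leq_mul2l IHt // => y yt.
have := irr y (mem_behead (s := x :: t) yt); apply: contra => /=.
apply/subsetP/gen_seqS => z; case: eqVneq => [_ /mem_rem//|_ zr].
by rewrite inE zr orbT.
Qed.

(** An entry already generated is dropped into [p]; any other is kept and moved to the base [t],
    where it at least doubles the order. *)
Lemma irredundant_extraction O t :
  exists O' p, [/\ perm_eq O (O' ++ p), subseq O' O,
    <<[set:: O' ++ t]>> = <<[set:: O ++ t]>> &
    2 ^ size O' * #|<<[set:: t]>>| <= #|<<[set:: O ++ t]>>|].
Proof.
elim: O t => [|x O IHO] t.
  by exists [::], [::]; split; rewrite // mul1n.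
have [xt|xt] := boolP (x \in <<[set:: t]>>).
  have [O' [p [eO sO genO' cardO']]] := IHO t.
  have eqx : <<[set:: x :: O ++ t]>> = <<[set:: O ++ t]>>.
    have subOt : <<[set:: t]>> \subset <<[set:: O ++ t]>>.
      by apply: gen_seqS => y yt; rewrite mem_cat yt orbT.
    apply/eqP; rewrite eqEsubset gen_seq_sub /= (subsetP subOt) //=.
    apply/andP; split; first by apply/allP => y; exact: mem_genl.
    by apply: gen_seqS => y yt; rewrite inE yt orbT.
  exists O', (x :: p); split; rewrite ?eqx //.
    by rewrite perm_sym perm_catC /= perm_cons perm_catC perm_sym.
  exact: subseq_trans sO (subseq_cons _ _).
have [O' [p [eO sO genO' cardO']]] := IHO (x :: t).
have mid A : <<[set:: (x :: A) ++ t]>> = <<[set:: A ++ x :: t]>>.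
  by apply: eq_gen_mem => y; rewrite /= inE !mem_cat inE orbCA.
exists (x :: O'), p; split; rewrite ?mid //=; first by rewrite perm_cons.
  by rewrite eqxx.
rewrite expnSr -mulnA; apply: leq_trans cardO'.
by rewrite leq_mul2l double_card_gen ?orbT.
Qed.

(** * Counting elements of [h M] in cosets of [H] *)

Lemma leq_card_cover (X : {set gT}) (Fs : seq {set gT}) c :
  (forall x, x \in X -> has (fun F : {set gT} => x \in F) Fs) ->
  {in Fs, forall F, #|X :&: F| <= c} -> #|X| <= size Fs * c.
Proof.
elim: Fs X => [|F Fs IHF] X cover le_c /=.
  by rewrite mul0n leqn0 cards_eq0; apply/eqP/setP=> x; rewrite inE;
    apply/negP => /cover.
rewrite mulSn -(cardsID F X) leq_add ?le_c ?mem_head // IHF //.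
  by move=> x; rewrite inE => /andP[xF /cover] /=; rewrite (negPf xF).
move=> F' F's; apply: leq_trans (le_c F' _); last by rewrite inE F's orbT.
by apply/subset_leq_card/setSI/subsetDl.
Qed.

(** If [z] is in the intersection, all of it lies in [z *: (M :&: H)]. *)
Lemma leq_card_lcosetI M h y : #|h *: M :&: y *: H| <= #|M :&: H|.
Proof.
case: (set_0Vmem (h *: M :&: y *: H)) => [->|[z]]; first by rewrite cards0.
rewrite inE !mem_lcoset => /andP[zM zH].
rewrite -(card_lcoset (M :&: H) z); apply/subset_leq_card/subsetP => w.
rewrite inE !mem_lcoset inE => /andP[wM wH]; apply/andP; split.
  by rewrite -(mulKVg h w) mulgA groupM // -groupV invMg invgK.
by rewrite -(mulKVg y w) mulgA groupM // -groupV invMg invgK.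
Qed.

(** For [w] and [z] in the intersection, [w z^-1] lies in [H] and in [h M h^-1]. Since [h] is in
    [H], the conjugate [h^-1 w z^-1 h] lies in [M :&: H]. *)
Lemma leq_card_lcoset_rcosetI M h y :
  h \in H -> #|h *: M :&: H :* y| <= #|M :&: H|.
Proof.
move=> hH; case: (set_0Vmem (h *: M :&: H :* y)) => [->|[z]].
  by rewrite cards0.
rewrite inE mem_lcoset mem_rcoset => /andP[zM zH].
rewrite -(card_lcoset (M :&: H) h) -(card_rcoset (h *: (M :&: H)) (h^-1 * z)).
apply/subset_leq_card/subsetP => w; rewrite inE mem_lcoset mem_rcoset.
case/andP=> wM wH; have wz : w * z^-1 \in H.
  by rewrite -(mulgKV y w) -mulgA groupM // -groupV invMg invgK.
rewrite mem_rcoset mem_lcoset; apply/setIP; split.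
  by rewrite mulgA groupM ?groupV.
by rewrite invMg invgK (mulgA w) groupM ?groupV // groupM.
Qed.

(** The sets to avoid are [H] and two cosets for each entry of [O]. Each takes at most [#|M :&: H|]
    elements of [h M], too few to cover it. *)
Lemma avoid_partial_transversal M O h :
  partial_transversal O -> h \in H -> (size O).*2.+1 < #|M : M :&: H| ->
  exists2 x, x \in h *: M & partial_transversal (x :: O).
Proof.
move=> ptO hH ltO.
have [x /andP[xM /hasPn xF]|full] :=
  pickP [pred x | x \in h *: M & ~~ has (fun F : {set gT} => x \in F)
    ((H : {set gT}) :: [seq y *: H | y <- O] ++ [seq H :* y | y <- O])].
  exists x => //; rewrite partial_transversal_cons ptO andbT.
  rewrite (xF H) ?mem_head //=; apply/allP => y yO; apply/andP; split.
    rewrite -groupV invMg invgK -mem_lcoset xF // inE mem_cat.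
    by rewrite (map_f (fun y => y *: H)) ?orbT.
  by rewrite -mem_rcoset xF // inE mem_cat (map_f (fun y => H :* y)) ?orbT.
have := @leq_card_cover (h *: M)
  ((H : {set gT}) :: [seq y *: H | y <- O] ++ [seq H :* y | y <- O]) #|M :&: H|.
rewrite card_lcoset /= size_cat !size_map addnn => le.
have {le} := le _ _; rewrite -(LagrangeI M H) mulnC leq_pmul2r ?cardG_gt0 //.
rewrite leqNgt -indexgI ltO => le; suff: ~~ true by []; apply: le => [x xM|F].
  by have := full x; rewrite /= xM => /negbFE.
rewrite inE mem_cat => /or3P[/eqP->|/mapP[y _ ->]|/mapP[y _ ->]].
- by have := leq_card_lcosetI M h 1; rewrite lcoset1.
- exact: leq_card_lcosetI.
- exact: leq_card_lcoset_rcosetI.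
Qed.

(** If [n <= 2 j + 1], then [n (n - 1) <= 2 j (2 j + 1) < 6 * 2 ^ j]. The factor 6 is tight: at
    [j = 2] the comparison is 20 with 24, at [j = 3] it is 42 with 48. *)
Lemma exp2_bound j n : 0 < j -> 6 * 2 ^ j <= n * n.-1 -> j.*2.+1 < n.
Proof.
move=> j0 le; rewrite ltnNge; apply: contraL le => nj; rewrite -ltnNge.
apply: (@leq_ltn_trans (j.*2.+1 * j.*2)).
  by rewrite leq_mul // -ltnS; case: n nj.
rewrite -muln2; case: j j0 {nj} => // j _.
(* Exponents 1 to 4 are computed; from 5 on, the left side less than doubles at each step. *)
do 4?[case: j => // j].
elim: j => [//|j IHj]; move: IHj; rewrite !expnS.
by set e := (2 ^ j)%N; nia.
Qed.

(** * Enlarging the partial transversal until it is complete *)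

Lemma nielsen_improve O hs :
  malnormal_in G H -> ~~ (G \subset H) ->
  partial_transversal O -> all [in H] hs -> <<[set:: O ++ hs]>> = G ->
  size O + size hs = #|G : H| -> 1 < size hs ->
  exists O' hs', [/\ nielsen_equiv (O ++ hs) (O' ++ hs'), partial_transversal O',
    all [in H] hs', size O' + size hs' = #|G : H| & size O < size O'].
Proof.
move=> mal nGH ptO hsH gen sz lt1.
have [/hasP[h hhs red]|/hasPn irr] :=
  boolP (has (fun h => h \in <<[set:: O ++ rem h hs]>>) hs).
  have e : perm_eq (O ++ hs) ((O ++ rem h hs) ++ [:: h]).
    by rewrite -catA perm_cat2l (permPl (perm_to_rem hhs)) perm_sym perm_catC.
  have genr : <<[set:: O ++ rem h hs]>> = G.
    apply/eqP; rewrite eqEsubset subsetT /= -gen (eq_gen_mem (perm_mem e)).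
    rewrite gen_seq_sub all_cat /= red andbT andbT.
    by apply/allP=> y; exact: mem_genl.
  have szr := size_rem hhs.
  have [|q [szq ptq mq]] := nielsen_refill (p := [:: h]) ptO genr.
    by rewrite /= -sz ltn_add2l.
  exists (q ++ O), (rem h hs); split => //.
  - by apply: nielsen_trans mq; exact: nielsen_perm.
  - by apply/allP=> y /mem_rem /(allP hsH).
  - by rewrite size_cat szq szr -sz /=; lia.
  by rewrite size_cat szq /=.
case: hs hsH gen sz lt1 irr => // h t /andP[hH tH] gen sz lt1 irr.
have irr' x : x \in t -> x \notin <<[set:: O ++ rem x t]>>.
  move=> xt; have := irr x (mem_behead (s := h :: t) xt); apply: contra => /=.
  apply/subsetP/gen_seqS => z; rewrite !mem_cat => /orP[->//|].
  by case: eqVneq => [_ /mem_rem ->|_ zr]; rewrite ?inE ?zr !orbT.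
have hM : h \notin <<[set:: O ++ t]>>.
  by have := irr h (mem_head _ _); rewrite /= eqxx.
(* With [O] empty, [hs] would generate [G] inside [H]. The head [o] is set apart so that extraction
   can start from [o :: t]. *)
case: O ptO gen sz {irr} irr' hM => [|o O] ptO gen sz irr' hM.
  by case/negP: nGH; rewrite -gen gen_seq_sub /= hH.
have oH : o \notin H by case/andP: ptO => /andP[].
pose M := <<[set:: (o :: O) ++ t]>>%G.
have szO : size (o :: O) < #|M : M :&: H|.
  apply: partial_transversal_size => // y yO.
  by rewrite mem_genl // mem_cat yO.
have tM : <<[set:: t]>> \subset M.
  by apply: gen_seqS => y yt; rewrite mem_cat yt orbT.
have cardC : 2 ^ size t <= #|M :&: H|.
  apply: leq_trans (irredundant_card _) _.
    move=> x xt; apply: contra (irr' x xt).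
    by apply/subsetP/gen_seqS => z zr; rewrite mem_cat zr orbT.
  by apply: subset_leq_card; rewrite subsetI tM gen_seq_sub.
have indexM : #|G : H| <= #|M : M :&: H|.
  have dG : #|M :&: H| %| #|G : H|.-1.
    apply: dvdn_trans (cardSg (subsetIr M H)) (malnormal_dvd_index _ mal).
    exact: subsetT.
  have dM : #|M :&: H| %| #|M : M :&: H|.-1.
    exact: malnormal_dvd_index (subsetIl _ _) (malnormalI (subsetT M) mal).
  (* Otherwise [#|M :&: H|] divides a positive difference of indices. By [sz] and [szO] that
     difference is at most [size t], which is below [2 ^ size t]. *)
  rewrite leqNgt; apply/negP => ltM.
  have := dvdn_sub dG dM; move/dvdn_leq.
  have := ltn_expl (size t) (ltnSn 1); have := indexg_gt0 M (M :&: H).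
  clear -sz szO ltM cardC; move: sz szO ltM cardC => /=.
  move: #|G : H| #|M : _| #|M :&: H| (2 ^ size t)%N => n m c e; lia.
(* An entry of [t] is not 1, by irredundancy, so [L :&: H] has order at least 2; by malnormality its
   index in [L] is larger still, hence at least 3. *)
have card6 : 6 <= #|<<[set:: o :: t]>>|.
  set L := <<[set:: o :: t]>>%G.
  have [x xt] : exists x, x \in t.
    by case: (t) lt1 => // x ?; exists x; rewrite mem_head.
  have D2 : 1 < #|L :&: H|.
    rewrite cardG_gt1; apply: contraNneq (irr' x xt) => L1.
    suff -> : x = 1 by [].
    by apply/set1gP; rewrite -L1 inE (allP tH) // mem_genl // inE xt orbT.
  have nLD : ~~ (L \subset L :&: H).
    rewrite subsetI subxx /=; apply: contra oH => /subsetP; apply.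
    exact/mem_genl/mem_head.
  have := malnormal_index_gt (subsetIl _ _) nLD (malnormalI (subsetT L) mal).
  move: D2; rewrite -[#|<<_>>|]/#|L| -(Lagrange (subsetIl L H)) => D2 lt.
  exact: (@leq_mul 2 3 _ _ D2 (leq_ltn_trans D2 lt)).
have [O' [p [eO sO genO' cardO']]] := irredundant_extraction O (o :: t).
have mid A : <<[set:: (o :: A) ++ t]>> = <<[set:: A ++ o :: t]>>.
  by apply: eq_gen_mem => y; rewrite /= inE !mem_cat inE orbCA.
have genM : <<[set:: (o :: O') ++ t]>> = M by rewrite mid genO' -mid.
have ptoO' : partial_transversal (o :: O').
  by apply: partial_transversal_subseq ptO; rewrite /= eqxx.
have small : (size (o :: O')).*2.+1 < #|M : M :&: H|.
  apply: leq_trans indexM; apply: exp2_bound => //.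
  (* Here [j] is [size (o :: O')]: the factor 2 from [M] being proper supplies the power of 2 that
     belongs to [o]. *)
  have ltH := malnormal_index_gt (subsetT H) nGH mal.
  have : 2 * #|M| <= #|H| * #|G : H|.
    rewrite (Lagrange (subsetT H)); apply: double_card; first exact: subsetT.
    by apply: contra hM => /subsetP; apply; rewrite inE.
  have -> : #|M| = #|<<[set:: O ++ o :: t]>>| by rewrite /M -mid.
  have : 2 ^ size O' * 6 <= #|<<[set:: O ++ o :: t]>>|.
    by apply: leq_trans cardO'; rewrite leq_mul2l card6 orbT.
  have : #|H| * #|G : H| <= #|G : H|.-1 * #|G : H|.
    by rewrite leq_mul2r; apply/orP; right; rewrite -ltnS prednK.
  clear; rewrite /= expnS; move: #|G : H| #|H| #|<<_>>| (2 ^ size O')%N => n q m e.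
  lia.
have [x xM ptx] := avoid_partial_transversal ptoO' hH small.
have xE : x = h * (h^-1 * x) by rewrite mulKVg.
have hxM : h^-1 * x \in M by rewrite -mem_lcoset.
have genx : <<[set:: (x :: o :: O') ++ t]>> = G.
  have [_ <-] : nielsen_equiv (h :: (o :: O') ++ t) (x :: (o :: O') ++ t).
    by rewrite xE; apply: nielsenMr; rewrite genM.
  apply/eqP; rewrite eqEsubset subsetT /= -gen gen_seq_sub.
  have sub : M \subset <<[set:: h :: (o :: O') ++ t]>>.
    by rewrite -genM; apply: gen_seqS => y yt; rewrite inE yt orbT.
  rewrite all_cat /= [h \in _]mem_genl ?mem_head //=.
  have inM y : y \in (o :: O) ++ t -> y \in <<[set:: h :: (o :: O') ++ t]>>.
    by move=> yM; apply: (subsetP sub); exact: mem_genl.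
  rewrite inM ?mem_head //=; apply/andP.
  by split; apply/allP=> y yO; apply: inM; rewrite mem_cat ?inE yO ?orbT.
have szO'p : size O = size O' + size p by rewrite (perm_size eO) size_cat.
have [|q [szq ptq mq]] := nielsen_refill (p := p) ptx genx.
  by clear -sz lt1 szO'p; move: sz lt1; rewrite /= szO'p; lia.
exists (q ++ x :: o :: O'), t; split => //.
- apply: nielsen_trans mq.
  apply: (@nielsen_trans _ _ (h :: ((o :: O') ++ t) ++ p)).
    apply: nielsen_perm; rewrite perm_catC /= perm_cons perm_catC /= perm_cons.
    by rewrite (permPl (perm_cat eO (perm_refl t))) -!catA perm_cat2l perm_catC.
  rewrite xE; apply: nielsenMr; apply: (subsetP _ _ hxM); rewrite -genM.
  by apply: gen_seqS => y yt; rewrite mem_cat yt.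
- by clear -sz szq szO'p; move: sz; rewrite size_cat szq /= szO'p; lia.
by clear -szq szO'p; rewrite size_cat szq /= szO'p; lia.
Qed.

Lemma nielsen_left_right s :
  malnormal_in G H -> ~~ (G \subset H) -> <<[set:: s]>> = G ->
  size s = #|G : H| ->
  exists t, [/\ nielsen_equiv s t, pairwise separated t & size t = #|G : H|].
Proof.
move=> mal nGH gen sz.
have [O [hs [m ptO hsH]]] := nielsen_reduce s; rewrite sz => szO.
(* The measure drops each time [O] grows, as [size O] stays below the index. *)
have [k] := ubnP (#|G : H| - size O).
elim: k O hs m ptO hsH szO => // k IHk O hs m ptO hsH szO le_k.
have ltO : size O < #|G : H|.
  have := partial_transversal_size (L := G) ptO.
  by rewrite indexgI; apply => x; rewrite inE.
have [lt1|] := ltnP 1 (size hs).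
  have genO : <<[set:: O ++ hs]>> = G by case: m => _ <-.
  have [O' [hs' [m' ptO' hsH' szO' lt]]] :=
    nielsen_improve mal nGH ptO hsH genO szO lt1.
  apply: (IHk O' hs') => //; first exact: nielsen_trans m m'.
  by clear -lt le_k ltO; lia.
case: hs m hsH szO => [|h [|? ?]] //= m hsH szO _.
  by move: ltO; rewrite -szO addn0 ltnn.
case/andP: ptO => /allP OH sep.
(* The last entry [h] of [H] represents the trivial coset, which [O] avoids. *)
exists (h :: O); split; last by rewrite -szO /= addn1.
  by apply: nielsen_trans m (nielsen_perm _); rewrite perm_catC.
rewrite /= sep andbT; apply/allP => y yO; case/andP: hsH => hH _.
have /= yH := OH y yO.
by rewrite /separated !groupMl ?groupV ?yH.
Qed.

(** As many distinct cosets as the index are all of them. [cover] treats right cosets of [f y];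
    taking inversion for [f] gives the left cosets. *)
Lemma separated_cover t :
  pairwise separated t -> size t = #|G : H| ->
  forall g, (exists2 y, y \in t & y^-1 * g \in H) /\
            (exists2 y, y \in t & g * y^-1 \in H).
Proof.
move=> sep sz g.
have cover (f : gT -> gT) :
    {in t &, forall x y, f x * (f y)^-1 \in H -> x = y} ->
    forall z, exists2 y, y \in t & z * (f y)^-1 \in H.
  move=> f_inj z; have utf : uniq [seq H :* f y | y <- t].
    rewrite map_inj_in_uniq.
      by apply: pairwise_uniq sep => x; rewrite /separated mulVg group1.
    move=> x y xt yt /rcoset_eqP; rewrite mem_rcoset; exact: f_inj.
  have [||_ eq_t] := uniq_min_size (s2 := enum (rcosets H G)) utf.
  - move=> _ /mapP[y yt ->].
    by rewrite mem_enum mem_rcosets -[f y]mul1g mem_mulg ?inE.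
  - by rewrite size_map sz -cardE.
  have: H :* z \in [seq H :* f y | y <- t].
    by rewrite eq_t mem_enum mem_rcosets -[z]mul1g mem_mulg ?inE.
  by case/mapP=> y yt /rcoset_eqP; rewrite mem_rcoset; exists y.
split.
  have inv_inj : {in t &, forall x y, x^-1 * (y^-1)^-1 \in H -> x = y}.
    move=> x y xt yt; rewrite invgK => xy.
    by have [//|/andP[]] := pairwise_separated_mem sep xt yt; rewrite xy.
  have [y yt] := cover (fun y => y^-1) inv_inj g^-1.
  by rewrite -groupV invMg !invgK; exists y.
apply: (cover id) => x y xt yt xy.
by have [//|/andP[_]] := pairwise_separated_mem sep xt yt; rewrite xy.
Qed.

End PartialTransversals.

Local Open Scope fset_scope.
Local Open Scope mset_scope.
Local Open Scope classical_set_scope.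
Local Open Scope group_scope.

(** * From subgroups given as sets to finite groups *)

Section Subgroups.
Variables (G : groupType) (H : set G).
Hypothesis subH : is_subgroup H.

Lemma subgroup1 : H 1.
Proof. by case: subH => /set_mem. Qed.

Lemma subgroup_div a b : H a -> H b -> H (a * b^-1).
Proof.
move=> /mem_set aH /mem_set bH; apply: set_mem.
by case: subH => _ /(_ a b); apply.
Qed.

Lemma subgroupV a : H a -> H a^-1.
Proof. by move/(subgroup_div subgroup1); rewrite mul1g. Qed.

Lemma subgroupM a b : H a -> H b -> H (a * b).
Proof. by move=> aH /subgroupV bH; rewrite -[b]invgK; exact: subgroup_div. Qed.

Lemma malnormal_eq1 x h : malnormal H -> ~ H x -> H h -> H (x^-1 * h * x) -> h = 1.
Proof.
move=> mal xH hH hx; have : (Defs.conjugate x H `&` H) h.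
  split=> //; exists (x^-1 * h * x) => //.
  by rewrite !mulgA mulgV mul1g mulgK.
by rewrite mal.
Qed.

(** [H] injects into its finite set of left cosets, so [G] is a finite union of finite cosets. *)
Lemma malnormal_finite x :
  malnormal H -> finite_index H -> ~ H x -> finite_set [set: G].
Proof.
move=> mal fin xH; pose f h := Defs.lcoset (h * x) H.
have f_inj h k : H h -> H k -> f h = f k -> h = k.
  move=> hH kH e; have: f k (h * x).
    by rewrite -e; exists 1; rewrite ?mulg1 //; exact: subgroup1.
  case=> u uH /(canRL (mulKg _)) eu.
  suff /(canRL (mulKg _)) : k^-1 * h = 1 by rewrite invgK mulg1.
  apply: (malnormal_eq1 mal xH); first by apply: subgroupM => //; exact: subgroupV.
  by rewrite !mulgA -invMg -mulgA -eu.
have finH : finite_set H.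
  (* [g] inverts [f]; the default 1 is taken only at cosets outside the image of [f] on [H]. *)
  pose g A := xget 1 [set k | H k /\ A = f k].
  apply: sub_finite_set (finite_image g fin).
  move=> h hH; exists (f h); first by exists (h * x).
  by apply: xget_unique => // k [kH e]; symmetry; exact: f_inj.
apply: sub_finite_set (bigcup_finite fin (F := id) _).
  move=> g _; exists (Defs.lcoset g H); first by exists g.
  by exists 1; rewrite ?mulg1 //; exact: subgroup1.
by move=> _ [g _ <-]; exact: finite_image.
Qed.
End Subgroups.

Lemma finite_group_of_set (gT : finGroupType) (H : set gT) :
  @is_subgroup gT H -> exists K : {group gT}, forall x, x \in K <-> H x.
Proof.
move=> subH; have grH : group_set (finset (fun x : gT => x \in H)).
  apply/group_setP; split; first by rewrite inE; apply/mem_set/(subgroup1 subH).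
  move=> x y; rewrite !inE => /set_mem xH /set_mem yH.
  by apply/mem_set/(subgroupM subH).
by exists (group grH) => x; rewrite inE; split=> [/set_mem|/mem_set].
Qed.

(** One side counts left cosets, the other right cosets; the inversion [F] matches them. *)
Lemma subgroup_indexE (gT : finGroupType) (H : set gT) (K : {group gT}) :
  (forall x, x \in K <-> H x) -> @finite_index gT H ->
  @subgroup_index gT H = #|[set: gT]%SET : K|.
Proof.
move=> KH fin.
pose F (A : {set gT}) : set gT := [set z | z^-1 \in A].
have FE g : F (K :* g) = Defs.lcoset (g^-1 : gT) H.
  apply/predeqP=> z; rewrite /F /= mem_rcoset; split=> [zK|[h /KH hK <-]].
    exists (g * z); last by rewrite mulKg.
    by apply/KH; rewrite -groupV invMg.
  by rewrite invMg invgK mulgK groupV.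
have uF : uniq [seq F A | A <- enum (rcosets K [set: gT]%SET)].
  rewrite map_inj_uniq ?enum_uniq // => A B /predeqP eAB.
  apply/setP=> z; have := eAB z^-1; rewrite /F /= invgK => -[AB BA].
  by apply/idP/idP.
rewrite /subgroup_index [#|_ : _|]cardE -(size_map F).
apply: perm_size; apply: uniq_perm => // C; rewrite in_fset_set //.
apply/idP/mapP => [/set_mem[g _ <-]|[A]].
  exists (K :* g^-1); last by rewrite FE invgK.
  by rewrite mem_enum mem_rcosets -[g^-1]mul1g mem_mulg ?inE.
rewrite mem_enum => /rcosetsP[g _ ->] ->; rewrite FE.
by apply/mem_set; exists (g^-1).
Qed.

Lemma generates_finite (gT : finGroupType) (S : {mset gT}) :
  @generates gT S -> <<[set:: (S : seq gT)]>> = [set: gT]%SET.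
Proof.
move=> gen; apply/setP => z; rewrite [in RHS]inE.
have : (smallest (@is_subgroup gT) [set` S]) z by rewrite gen.
move/(_ [set w | w \in <<[set:: (S : seq gT)]>>]); apply.
split; last by move=> x xS; exact: mem_genl.
split=> [|x y /set_mem xS /set_mem yS]; apply/mem_set; first exact: group1.
by rewrite /= groupM ?groupV.
Qed.

Lemma left_right_transversal_finite (gT : finGroupType) (H : set gT)
  (K : {group gT}) (t : seq gT) :
  (forall x, x \in K <-> H x) -> pairwise (separated K) t ->
  size t = #|[set: gT]%SET : K| ->
  @left_right_transversal gT H [set` [fset x in t]].
Proof.
move=> KH sep sz; split=> _ [g _ <-].
  have [[y yt yg] _] := separated_cover sep sz g.
  exists y; split=> [|z [/= zt [h /KH hK ez]]].
    split; first by rewrite /= in_fset.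
    exists (g^-1 * y); last by rewrite mulKVg.
    by apply/KH; rewrite -groupV invMg invgK.
  move: zt; rewrite in_fset => zt.
  have [//|/andP[/negP[]]] := pairwise_separated_mem sep yt zt.
  by rewrite -ez mulgA groupM.
have [_ [y yt yg]] := separated_cover sep sz g.
exists y; split=> [|z [/= zt [h /KH hK ez]]].
  split; first by rewrite /= in_fset.
  exists (y * g^-1); last by rewrite mulgKV.
  by apply/KH; rewrite -groupV invMg invgK.
move: zt; rewrite in_fset => zt.
have [//|/andP[_ /negP[]]] := pairwise_separated_mem sep yt zt.
by rewrite -ez -groupV !invMg !invgK -mulgA groupM.
Qed.

Lemma seq_mset_fset (K : choiceType) (t : seq K) :
  uniq t -> seq_mset [fset x in t] = seq_mset t.
Proof.
move=> ut; apply/eq_seq_msetP/uniq_perm => // x; by rewrite in_fset.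
Qed.

(** * The case [H = G] and the reduction to a finite group *)

Theorem theorem1p6 (G : groupType) (H : set G) (S : {mset G}) :
  is_subgroup H -> malnormal H -> finite_index H ->
  size S = subgroup_index H -> generates S ->
  exists T : {fset G},
    nielsen_transformation S (seq_mset T) /\
    left_right_transversal H [set` T].
Proof.
move=> subH mal fin szS gen.
have [HT|[x xH]] : H = [set: G] \/ exists x, ~ H x.
  have [|/forallNP nH] := EM (exists x, ~ H x); [by right|left].
  by rewrite predeqE => x; split => // _; apply: contrapT; exact: nH.
  have lT g : Defs.lcoset g H = [set: G].
    rewrite predeqE => x; split => // _; exists (g^-1 * x); rewrite ?HT //.
    by rewrite mulKVg.
  have rT g : Defs.rcoset H g = [set: G].
    rewrite predeqE => x; split => // _; exists (x * g^-1); rewrite ?HT //.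
    by rewrite mulgKV.
  have idx1 : subgroup_index H = 1%N.
    rewrite /subgroup_index; suff -> : Defs.lcosets H = [set [set: G]].
      by rewrite fset_set1 cardfs1.
    rewrite predeqE => C; split=> [[g _ <-]|->]; first by rewrite lT.
    by exists 1.
  have [g eS] : exists g, (S : seq G) = [:: g].
    by move: szS; rewrite idx1; case: (S : seq G) => [|g [|? ?]] // _; exists g.
  exists [fset g]; split.
    rewrite -[S]seq_mset_id eS.
    suff -> : seq_mset [fset g] = seq_mset [:: g] by exact: rt_refl.
    by apply/eq_seq_msetP/uniq_perm => // y; rewrite in_fset1 mem_seq1.
  split=> _ [a _ <-]; rewrite ?lT ?rT.
    exists g; split=> [|y [/=]]; last by rewrite in_fset1 => /eqP.
    by split; rewrite //= in_fset1.
  exists g; split=> [|y [/=]]; last by rewrite in_fset1 => /eqP.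
  by split; rewrite //= in_fset1.
have [gT eG] := finite_groupP (malnormal_finite subH mal fin xH).
subst G; have [K KH] := finite_group_of_set subH.
have malK : malnormal_in [set: gT]%SET K.
  move=> y h _ yK /KH hH /KH hy; apply: (@malnormal_eq1 _ _ y _ mal) => //.
    by move/KH; apply/negP.
  by rewrite -mulgA.
have nGK : ~~ ([set: gT]%SET \subset K).
  by apply/subsetPn; exists x; rewrite ?inE //; apply/negP => /KH.
have idxK := subgroup_indexE KH fin.
have [t [[St _] sep szt]] :=
  nielsen_left_right malK nGK (generates_finite gen) (etrans szS idxK).
exists [fset y in t]; split; last exact: left_right_transversal_finite KH sep szt.
(* No element is separated from itself, so [t] has no repetition and no multiplicity is lost in the
   finite set. *)
rewrite -[S]seq_mset_id seq_mset_fset //.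
by apply: pairwise_uniq sep => y; rewrite /separated mulVg group1.
Qed.
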